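(* Let $(G,E,\varphi)$ be a self-similar triple and let $R$ be a unital commutative $*$-ring. Let $\mathcal{D}:=\operatorname{span}_R\{p_{v,f}:v\in E^0,f\in G\}\subseteq L_R(G,E)$. Fix $V\subseteq E^0$ such that $E^0=\bigsqcup_{v\in V}G\cdot v$ is a partition of $E^0$. For each $v\in V$ let $\mathcal{W}_v$ be the $*$-algebra over $R$ defined in the context. If $E$ is finite, or if $G\cdot v$ is finite for each $v\in V$, then, as $*$-algebras over $R$, $$\mathcal{D}\cong\bigoplus_{v\in V}\left(M_{G\cdot v}\otimes\mathcal{W}_v\right).$$
   Context: A unital commutative $*$-ring $R$ is a commutative ring with $1$ together with an involution $r\mapsto r^*$. A $*$-algebra over $R$ is an (associative, not necessarily unital) $R$-algebra with a map $a\mapsto a^*$ satisfying $(a^* )^*=a$, $(ab)^*=b^*a^*$, $(ra+b)^*=r^*a^*+b^*$. A projection is $p=p^*=p^2$; a partial isometry is $s=ss^*s$. A directed graph $E=(E^0,E^1,r,s)$ has countable vertex set $E^0$, countable edge set $E^1$ and maps $r,s\colon E^1\to E^0$. It is row-finite if $vE^1:=r^{-1}(v)$ is finite for all $v$, and has no sources if $vE^1\neq\emptyset$ for all $v$. An action of a group $G$ on $E$ is a homomorphism from $G$ to the group of bijections of $E^0\sqcup E^1$ that preserve $E^0$ and $E^1$ and commute with $r$ and $s$. A self-similar triple $(G,E,\varphi)$: a countable discrete group $G$ (unit $e_G$), a row-finite graph $E$ with no sources, an action of $G$ on $E$, and a map $\varphi\colon G\times E^1\to G$ with $\varphi(gh,e)=\varphi(g,h\cdot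 e)\varphi(h,e)$ and $\varphi(g,e)\cdot v=g\cdot v$ for all $g,h\in G$, $e\in E^1$, $v\in E^0$. An $E$-family in a $*$-algebra: mutually orthogonal projections $P_v$ ($v\in E^0$) and partial isometries $S_e$ ($e\in E^1$) with $S_e^*S_f=\delta_{e,f}P_{s(e)}$ and $P_v=\sum_{e\in vE^1}S_eS_e^*$. A $(G,E)$-family: elements $P_{v,f}$, $S_{e,g}$ ($v\in E^0$, $e\in E^1$, $f,g\in G$) such that (a) $\{P_{v,e_G}\}\cup\{S_{e,e_G}\}$ is an $E$-family; (b) $(P_{v,f})^*=P_{f^{-1}\cdot v,f^{-1}}$; (c) $P_{v,f}P_{w,h}=\delta_{v,f\cdot w}P_{v,fh}$; (d) $P_{v,f}S_{e,g}=\delta_{v,r(f\cdot e)}S_{f\cdot e,\varphi(f,e)g}$; (e) $S_{e,g}P_{v,f}=\delta_{g\cdot v,s(e)}S_{e,gf}$. $L_R(G,E)$ is the universal $*$-algebra over $R$ generated by a $(G,E)$-family $\{p_{v,f},s_{e,g}\}$. $M_X$ (for a nonempty set $X$) is the universal $*$-algebra over $R$ generated by $\{\eta_{x,y}:x,y\in X\}$ with $\eta_{x,y}^*=\eta_{y,x}$ and $\eta_{x,y}\eta_{w,z}=\delta_{y,w}\eta_{x,z}$ (finitely supported $X\times X$ matrices over $R$). $\otimes$ is the algebraic tensor product over $R$ with $(a\otimes b)^*=a^*\otimes b^*$. $\mathcal{W}_v$: let $v\in E^0$ have finite orbit $G\cdot v$. Put $g_v:=e_G$ and for each $w\in G\cdot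 v\setminus\{v\}$ fix $g_w\in G$ with $w=g_w\cdot v$. For $g\in\operatorname{Stab}_G(v)=\{g\in G:g\cdot v=v\}$ and $w\in G\cdot v$ put $e_{w,w}^g:=p_{w,g_w}p_{v,g}p_{w,g_w}^*=p_{w,g_wg g_w^{-1}}$ and $W_v^g:=\sum_{w\in G\cdot v}e_{w,w}^g$. Then $\mathcal{W}_v:=\operatorname{span}_R\{W_v^g:g\in\operatorname{Stab}_G(v)\}$, a $*$-subalgebra of $L_R(G,E)$. *)

(* Defs.v *)
From HB Require Import structures.
From mathcomp Require Import all_boot ssralg finmap.
From mathcomp Require Import all_classical.

Set Implicit Arguments.
Unset Strict Implicit.
Unset Printing Implicit Defensive.

Import GRing.Theory.
Local Open Scope classical_set_scope.
Local Open Scope ring_scope.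
Local Open Scope quotient_scope.

HB.mixin Record isStarRing R of GRing.ComPzRing R := {
  rstar : R -> R;
  rstarD : {morph rstar : x y / x + y};
  rstarM : {morph rstar : x y / x * y};
  rstarK : involutive rstar
}.

#[short(type="starRingType")]
HB.structure Definition StarRing := {R of isStarRing R & GRing.ComPzRing R}.

(* MathComp rings are unital, hence the separate product [amul]. *)
HB.mixin Record isStarAlg (R : starRingType) A of GRing.Lmodule R A := {
  amul : A -> A -> A;
  astar : A -> A;
  amulA : associative amul;
  amulDl : left_distributive amul +%R;
  amulDr : right_distributive amul +%R;
  ascaleAl : forall (r : R) (a b : A), r *: amul a b = amul (r *: a) b;
  ascaleAr : forall (r : R) (a b : A), r *: amul a b = amul a (r *: b);
  astarK : involutive astar;
  astarM : forall a b : A, astar (amul a b) = amul (astar b) (astar a);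
  astarP : forall (r : R) (a b : A),
    astar (r *: a + b) = rstar r *: astar a + astar b
}.

#[short(type="starAlgType")]
HB.structure Definition StarAlg (R : starRingType) :=
  {A of isStarAlg R A & GRing.Lmodule R A}.

Notation "a ** b" := (amul a b) (at level 40, left associativity)
  : ring_scope.
Notation "a ^*" := (astar a) : ring_scope.

Section StarAlgTheory.
Context {R : starRingType} {A : starAlgType R}.
Implicit Types a b : A.

Lemma amul0r a : 0 ** a = 0.
Proof. by apply: (addIr (0 ** a)); rewrite -amulDl !add0r. Qed.

Lemma amulr0 a : a ** 0 = 0.
Proof. by apply: (addIr (a ** 0)); rewrite -amulDr !add0r. Qed.

Lemma astarD a b : (a + b) ^* = a ^* + b ^*.
Proof.
rewrite -[a]scale1r astarP; congr (_ + _).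
have h r : rstar r *: (0 : A)^* = 0.
  have := astarP r (0 : A) 0; rewrite scaler0 addr0 => h.
  by apply: (addIr (0 : A)^*); rewrite add0r -h.
have s0 : (0 : A)^* = 0.
  by have := h (rstar 1); rewrite rstarK scale1r.
by have := astarP 1 a 0; rewrite s0 !addr0.
Qed.

Lemma astar0 : (0 : A)^* = 0.
Proof. by apply: (addIr (0 : A)^*); rewrite -astarD !add0r. Qed.

Lemma astarZ (r : R) a : (r *: a)^* = rstar r *: a^*.
Proof. by rewrite -[r *: a]addr0 astarP astar0 addr0. Qed.

Lemma astarN a : (- a)^* = - a^*.
Proof. by apply: (addIr a^*); rewrite addNr -astarD addNr astar0. Qed.

Lemma amulNr a b : (- a) ** b = - (a ** b).
Proof. by apply: (addIr (a ** b)); rewrite addNr -amulDl addNr amul0r. Qed.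

End StarAlgTheory.

Record star_hom (R : starRingType) (A B : starAlgType R) (f : A -> B) : Prop :=
  StarHom {
    star_homD : {morph f : a b / a + b};
    star_homZ : forall r : R, {morph f : a / r *: a};
    star_homM : {morph f : a b / a ** b};
    star_homS : {morph f : a / a^* }
  }.

Lemma star_hom0 (R : starRingType) (A B : starAlgType R) (f : A -> B) :
  star_hom f -> f 0 = 0.
Proof. by case=> fD _ _ _; apply: (addIr (f 0)); rewrite -fD !add0r. Qed.

Lemma star_homN (R : starRingType) (A B : starAlgType R) (f : A -> B) :
  star_hom f -> {morph f : a / - a}.
Proof.
move=> fh a; apply: (addIr (f a)).
by rewrite -(star_homD fh) !addNr star_hom0.
Qed.

Definition star_isomorphic (R : starRingType) (A B : starAlgType R) : Prop :=
  exists f : A -> B, star_hom f /\ bijective f.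

Definition projection (R : starRingType) (A : starAlgType R) (p : A) : Prop :=
  p = p^* /\ p = p ** p.

Definition partial_isometry (R : starRingType) (A : starAlgType R) (s : A) :
  Prop := s = s ** s^* ** s.

(* [univ_alg P] is the universal star-algebra generated by a family of       *)
(* elements indexed by [X] and satisfying [P]: formal star-algebra           *)
(* expressions in [X], two of them being identified when they take the same  *)
(* value at every family satisfying [P] in every star-algebra.               *)

Inductive star_expr (R X : Type) : Type :=
| EGen of X
| EZero
| EAdd of star_expr R X & star_expr R X
| EOpp of star_expr R X
| EScale of R & star_expr R X
| EMul of star_expr R X & star_expr R X
| EStar of star_expr R X.
Arguments EGen {R X}.
Arguments EZero {R X}.

HB.instance Definition _ (R X : Type) := gen_eqMixin (star_expr R X).
HB.instance Definition _ (R X : Type) := gen_choiceMixin (star_expr R X).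

Fixpoint star_eval (R : starRingType) (X : Type) (A : starAlgType R)
    (x : X -> A) (t : star_expr R X) : A :=
  match t with
  | EGen i => x i
  | EZero => 0
  | EAdd t u => star_eval x t + star_eval x u
  | EOpp t => - star_eval x t
  | EScale r t => r *: star_eval x t
  | EMul t u => star_eval x t ** star_eval x u
  | EStar t => (star_eval x t)^*
  end.

Section UniversalAlgebra.
Variables (R : starRingType) (X : Type).
Variable P : forall A : starAlgType R, (X -> A) -> Prop.

Definition univ_rel : rel (star_expr R X) := fun t u =>
  `[< forall (A : starAlgType R) (x : X -> A), P x ->
        star_eval x t = star_eval x u >].

Lemma univ_rel_equiv : equiv_class_of univ_rel.
Proof.
split=> [t|t u|t u v].
- exact/asboolP.
- by apply/asbool_equiv_eq; split=> h A x Px; rewrite h.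
- by move=> /asboolP h1 /asboolP h2; apply/asboolP => A x Px; rewrite h1 ?h2.
Qed.

Canonical univ_equiv := EquivRelPack univ_rel_equiv.

Definition univ_alg := {eq_quot univ_equiv}.
HB.instance Definition _ := Choice.on univ_alg.

Definition univ_gen (i : X) : univ_alg := \pi_univ_alg (EGen i).

Definition univ_lift (A : starAlgType R) (x : X -> A) (a : univ_alg) : A :=
  star_eval x (repr a).

Lemma univ_liftE (A : starAlgType R) (x : X -> A) t :
  P x -> univ_lift x (\pi_univ_alg t) = star_eval x t.
Proof.
move=> Px; rewrite /univ_lift; have : repr (\pi_univ_alg t) = t %[mod univ_alg].
  by rewrite reprK.
by move/eqmodP => /asboolP /(_ A x Px).
Qed.

Lemma univ_ext (a b : univ_alg) :
  (forall (A : starAlgType R) (x : X -> A), P x ->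
     univ_lift x a = univ_lift x b) -> a = b.
Proof.
move=> h; rewrite -[a]reprK -[b]reprK; apply/eqmodP/asboolP => A x Px.
exact: h.
Qed.

Definition univ_zero : univ_alg := \pi_univ_alg EZero.
Definition univ_add (a b : univ_alg) : univ_alg :=
  \pi_univ_alg (EAdd (repr a) (repr b)).
Definition univ_opp (a : univ_alg) : univ_alg := \pi_univ_alg (EOpp (repr a)).
Definition univ_scale (r : R) (a : univ_alg) : univ_alg :=
  \pi_univ_alg (EScale r (repr a)).
Definition univ_mul (a b : univ_alg) : univ_alg :=
  \pi_univ_alg (EMul (repr a) (repr b)).
Definition univ_star (a : univ_alg) : univ_alg := \pi_univ_alg (EStar (repr a)).

Let opE (A : starAlgType R) (x : X -> A) (Px : P x) :
  (univ_lift x univ_zero = 0) *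
  (forall a b, univ_lift x (univ_add a b) = univ_lift x a + univ_lift x b) *
  (forall a, univ_lift x (univ_opp a) = - univ_lift x a) *
  (forall r a, univ_lift x (univ_scale r a) = r *: univ_lift x a) *
  (forall a b, univ_lift x (univ_mul a b) = univ_lift x a ** univ_lift x b) *
  (forall a, univ_lift x (univ_star a) = (univ_lift x a)^* ).
Proof. by do !split=> *; rewrite univ_liftE. Qed.

Lemma univ_addA : associative univ_add.
Proof. by move=> a b c; apply: univ_ext => A x Px; rewrite !(opE Px) addrA. Qed.
Lemma univ_addC : commutative univ_add.
Proof. by move=> a b; apply: univ_ext => A x Px; rewrite !(opE Px) addrC. Qed.
Lemma univ_add0 : left_id univ_zero univ_add.
Proof. by move=> a; apply: univ_ext => A x Px; rewrite !(opE Px) add0r. Qed.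
Lemma univ_addN : left_inverse univ_zero univ_opp univ_add.
Proof. by move=> a; apply: univ_ext => A x Px; rewrite !(opE Px) addNr. Qed.

HB.instance Definition _ :=
  GRing.isZmodule.Build univ_alg univ_addA univ_addC univ_add0 univ_addN.

Lemma univ_scaleA r s a :
  univ_scale r (univ_scale s a) = univ_scale (r * s) a.
Proof. by apply: univ_ext => A x Px; rewrite !(opE Px) scalerA. Qed.
Lemma univ_scale1 : left_id 1 univ_scale.
Proof. by move=> a; apply: univ_ext => A x Px; rewrite !(opE Px) scale1r. Qed.
Lemma univ_scaleDr : right_distributive univ_scale +%R.
Proof. by move=> r a b; apply: univ_ext => A x Px; rewrite !(opE Px) scalerDr. Qed.
Lemma univ_scaleDl a : {morph univ_scale^~ a : r s / r + s}.
Proof. by move=> r s; apply: univ_ext => A x Px; rewrite !(opE Px) scalerDl. Qed.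

HB.instance Definition _ := GRing.Zmodule_isLmodule.Build R univ_alg
  univ_scaleA univ_scale1 univ_scaleDr univ_scaleDl.

Lemma univ_mulA : associative univ_mul.
Proof. by move=> a b c; apply: univ_ext => A x Px; rewrite !(opE Px) amulA. Qed.
Lemma univ_mulDl : left_distributive univ_mul +%R.
Proof. by move=> a b c; apply: univ_ext => A x Px; rewrite !(opE Px) amulDl. Qed.
Lemma univ_mulDr : right_distributive univ_mul +%R.
Proof. by move=> a b c; apply: univ_ext => A x Px; rewrite !(opE Px) amulDr. Qed.
Lemma univ_scaleAl (r : R) (a b : univ_alg) :
  r *: univ_mul a b = univ_mul (r *: a) b.
Proof. by apply: univ_ext => A x Px; rewrite !(opE Px) ascaleAl. Qed.
Lemma univ_scaleAr (r : R) (a b : univ_alg) :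
  r *: univ_mul a b = univ_mul a (r *: b).
Proof. by apply: univ_ext => A x Px; rewrite !(opE Px) ascaleAr. Qed.
Lemma univ_starK : involutive univ_star.
Proof. by move=> a; apply: univ_ext => A x Px; rewrite !(opE Px) astarK. Qed.
Lemma univ_starM a b :
  univ_star (univ_mul a b) = univ_mul (univ_star b) (univ_star a).
Proof. by apply: univ_ext => A x Px; rewrite !(opE Px) astarM. Qed.
Lemma univ_starP (r : R) (a b : univ_alg) :
  univ_star (r *: a + b) = rstar r *: univ_star a + univ_star b.
Proof. by apply: univ_ext => A x Px; rewrite !(opE Px) astarP. Qed.

HB.instance Definition _ := isStarAlg.Build R univ_alg univ_mulA univ_mulDl
  univ_mulDr univ_scaleAl univ_scaleAr univ_starK univ_starM univ_starP.

Lemma univ_lift_hom (A : starAlgType R) (x : X -> A) :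
  P x -> star_hom (univ_lift x).
Proof.
move=> Px; split=> *; first exact: (opE Px).1.1.1.1.2.
- exact: (opE Px).1.1.2.
- exact: (opE Px).1.2.
- exact: (opE Px).2.
Qed.

Lemma univ_lift_gen (A : starAlgType R) (x : X -> A) i :
  P x -> univ_lift x (univ_gen i) = x i.
Proof. exact: univ_liftE. Qed.

Lemma univ_lift_unique (A : starAlgType R) (x : X -> A) (f : univ_alg -> A) :
  P x -> star_hom f -> (forall i, f (univ_gen i) = x i) -> f =1 univ_lift x.
Proof.
move=> Px fh fx; have [fD fZ fM fS] := fh; have fN := star_homN fh.
pose cl t : univ_alg := \pi_univ_alg t.
have clD t u : cl (EAdd t u) = cl t + cl u.
  apply: univ_ext => B y Py; have [hD _ _ _] := univ_lift_hom Py.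
  by rewrite hD !univ_liftE.
have clM t u : cl (EMul t u) = cl t ** cl u.
  apply: univ_ext => B y Py; have [_ _ hM _] := univ_lift_hom Py.
  by rewrite hM !univ_liftE.
have clN t : cl (EOpp t) = - cl t.
  apply: univ_ext => B y Py; rewrite (star_homN (univ_lift_hom Py)).
  by rewrite !univ_liftE.
have clZ r t : cl (EScale r t) = r *: cl t.
  apply: univ_ext => B y Py; have [_ hZ _ _] := univ_lift_hom Py.
  by rewrite hZ !univ_liftE.
have clS t : cl (EStar t) = (cl t)^*.
  apply: univ_ext => B y Py; have [_ _ _ hS] := univ_lift_hom Py.
  by rewrite hS !univ_liftE.
suff h t : f (cl t) = star_eval x t by move=> a; rewrite -[a]reprK h univ_liftE.
elim: t => //=; first exact: star_hom0 fh.
- by move=> t IHt u IHu; rewrite clD fD IHt IHu.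
- by move=> t IHt; rewrite clN fN IHt.
- by move=> r t IHt; rewrite clZ fZ IHt.
- by move=> t IHt u IHu; rewrite clM fM IHt IHu.
- by move=> t IHt; rewrite clS fS IHt.
Qed.

End UniversalAlgebra.

Definition matrix_units (R : starRingType) (X : eqType) (A : starAlgType R)
    (eta : X * X -> A) : Prop :=
  (forall x y, (eta (x, y))^* = eta (y, x)) /\
  (forall x y w z, eta (x, y) ** eta (w, z) = if y == w then eta (x, z) else 0).

Definition mx_alg (R : starRingType) (X : eqType) : starAlgType R :=
  univ_alg (@matrix_units R X).

Definition mx_unit (R : starRingType) (X : eqType) (x y : X) : mx_alg R X :=
  univ_gen (@matrix_units R X) (x, y).

Lemma mx_unitP (R : starRingType) (X : eqType) :
  @matrix_units R X (mx_alg R X) (fun xy => mx_unit R xy.1 xy.2).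
Proof.
split=> [x y|x y w z].
- apply: univ_ext => A a Pa; have [_ _ _ lS] := univ_lift_hom Pa.
  by rewrite lS !univ_lift_gen // Pa.1.
- apply: univ_ext => A a Pa; have [_ _ lM _] := univ_lift_hom Pa.
  rewrite lM !univ_lift_gen // Pa.2; case: eqP => _.
    by rewrite univ_lift_gen.
  by rewrite (star_hom0 (univ_lift_hom Pa)).
Qed.

(* [tensor A B] consists of formal finite sums of pairs (standing for        *)
(* elementary tensors), two of them being identified when every balanced     *)
(* biadditive map into an abelian group takes the same value on them.        *)

Record balanced (R : pzRingType) (A B : lmodType R) (M : zmodType)
    (f : A -> B -> M) : Prop := Balanced {
  balDl : forall a a' b, f (a + a') b = f a b + f a' b;
  balDr : forall a b b', f a (b + b') = f a b + f a b';
  balZ : forall r a b, f (r *: a) b = f a (r *: b)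
}.

Section Tensor.
Variables (R : starRingType) (A B : starAlgType R).

Definition tensor_eval (M : zmodType) (f : A -> B -> M) (t : seq (A * B)) : M :=
  \sum_(p <- t) f p.1 p.2.

Definition tensor_rel : rel (seq (A * B)) := fun t u =>
  `[< forall (M : zmodType) (f : A -> B -> M), balanced f ->
        tensor_eval f t = tensor_eval f u >].

Lemma tensor_rel_equiv : equiv_class_of tensor_rel.
Proof.
split=> [t|t u|t u v].
- exact/asboolP.
- by apply/asbool_equiv_eq; split=> h M f bf; rewrite h.
- by move=> /asboolP h1 /asboolP h2; apply/asboolP => M f bf; rewrite h1 ?h2.
Qed.

Canonical tensor_equiv := EquivRelPack tensor_rel_equiv.

Definition tensor := {eq_quot tensor_equiv}.
HB.instance Definition _ := Choice.on tensor.

Definition tens (a : A) (b : B) : tensor := \pi_tensor [:: (a, b)].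

Definition tensor_lift (M : zmodType) (f : A -> B -> M) (t : tensor) : M :=
  tensor_eval f (repr t).

Lemma tensor_liftE (M : zmodType) (f : A -> B -> M) t :
  balanced f -> tensor_lift f (\pi_tensor t) = \sum_(p <- t) f p.1 p.2.
Proof.
move=> bf; rewrite /tensor_lift; have : repr (\pi_tensor t) = t %[mod tensor].
  by rewrite reprK.
by move/eqmodP => /asboolP /(_ M f bf).
Qed.

Lemma tensor_ext (t u : tensor) :
  (forall (M : zmodType) (f : A -> B -> M), balanced f ->
     tensor_lift f t = tensor_lift f u) -> t = u.
Proof.
move=> h; rewrite -[t]reprK -[u]reprK; apply/eqmodP/asboolP => M f bf.
exact: h.
Qed.

Lemma eq_tensor_lift (M : zmodType) (f g : A -> B -> M) t :
  f =2 g -> tensor_lift f t = tensor_lift g t.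
Proof. by move=> fg; apply: eq_bigr => p _; rewrite fg. Qed.

Lemma tensor_lift_tens (M : zmodType) (f : A -> B -> M) a b :
  balanced f -> tensor_lift f (tens a b) = f a b.
Proof. by move=> bf; rewrite tensor_liftE // big_seq1. Qed.

Definition tensor_zero : tensor := \pi_tensor [::].
Definition tensor_add (t u : tensor) : tensor := \pi_tensor (repr t ++ repr u).
Definition tensor_opp (t : tensor) : tensor :=
  \pi_tensor [seq (- p.1, p.2) | p <- repr t].
Definition tensor_scale (r : R) (t : tensor) : tensor :=
  \pi_tensor [seq (r *: p.1, p.2) | p <- repr t].
Definition tensor_mul (t u : tensor) : tensor :=
  \pi_tensor [seq (p.1 ** q.1, p.2 ** q.2) | p <- repr t, q <- repr u].
Definition tensor_star (t : tensor) : tensor :=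
  \pi_tensor [seq (p.1 ^*, p.2 ^*) | p <- repr t].

Lemma tlift0 (M : zmodType) (f : A -> B -> M) :
  balanced f -> tensor_lift f tensor_zero = 0.
Proof. by move=> bf; rewrite tensor_liftE // big_nil. Qed.

Lemma tliftD (M : zmodType) (f : A -> B -> M) t u : balanced f ->
  tensor_lift f (tensor_add t u) = tensor_lift f t + tensor_lift f u.
Proof. by move=> bf; rewrite tensor_liftE // big_cat. Qed.

Lemma balNl (M : zmodType) (f : A -> B -> M) a b :
  balanced f -> f (- a) b = - f a b.
Proof.
move=> bf; apply: (addIr (f a b)); rewrite -balDl // !addNr.
by apply: (addIr (f 0 b)); rewrite -balDl // !add0r.
Qed.

Lemma tliftN (M : zmodType) (f : A -> B -> M) t : balanced f ->
  tensor_lift f (tensor_opp t) = - tensor_lift f t.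
Proof.
move=> bf; rewrite tensor_liftE // big_map -sumrN.
by apply: eq_bigr => p _; rewrite balNl.
Qed.

Lemma tliftZ (M : zmodType) (f : A -> B -> M) r t : balanced f ->
  tensor_lift f (tensor_scale r t) = tensor_lift (fun a b => f (r *: a) b) t.
Proof. by move=> bf; rewrite tensor_liftE // big_map. Qed.

Lemma tliftS (M : zmodType) (f : A -> B -> M) t : balanced f ->
  tensor_lift f (tensor_star t) = tensor_lift (fun a b => f a^* b^*) t.
Proof. by move=> bf; rewrite tensor_liftE // big_map. Qed.

Lemma tliftM (M : zmodType) (f : A -> B -> M) t u : balanced f ->
  tensor_lift f (tensor_mul t u) =
  tensor_lift (fun a b => tensor_lift (fun c d => f (a ** c) (b ** d)) u) t.
Proof. by move=> bf; rewrite tensor_liftE // big_allpairs_dep. Qed.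

Lemma balancedZ (M : zmodType) (f : A -> B -> M) r : balanced f ->
  balanced (fun a b => f (r *: a) b).
Proof.
move=> bf; split=> [a a' b|a b b'|s a b].
- by rewrite scalerDr balDl.
- by rewrite balDr.
- by rewrite scalerA mulrC -scalerA balZ.
Qed.

Lemma balancedS (M : zmodType) (f : A -> B -> M) : balanced f ->
  balanced (fun a b => f a^* b^*).
Proof.
move=> bf; split=> [a a' b|a b b'|s a b].
- by rewrite astarD balDl.
- by rewrite astarD balDr.
- by rewrite !astarZ balZ.
Qed.

Lemma balancedMl (M : zmodType) (f : A -> B -> M) c d : balanced f ->
  balanced (fun a b => f (c ** a) (d ** b)).
Proof.
move=> bf; split=> [a a' b|a b b'|s a b].
- by rewrite amulDr balDl.
- by rewrite amulDr balDr.
- by rewrite -!ascaleAr balZ.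
Qed.

Lemma balancedMr (M : zmodType) (f : A -> B -> M) u : balanced f ->
  balanced (fun a b => tensor_lift (fun c d => f (a ** c) (b ** d)) u).
Proof.
move=> bf; rewrite /tensor_lift /tensor_eval; split=> [a a' b|a b b'|s a b].
- by rewrite -big_split; apply: eq_bigr => p _; rewrite amulDl balDl.
- by rewrite -big_split; apply: eq_bigr => p _; rewrite amulDl balDr.
- by apply: eq_bigr => p _; rewrite -!ascaleAl balZ.
Qed.

Lemma tensor_addA : associative tensor_add.
Proof. by move=> t u v; apply: tensor_ext => M f bf; rewrite !tliftD ?addrA. Qed.
Lemma tensor_addC : commutative tensor_add.
Proof. by move=> t u; apply: tensor_ext => M f bf; rewrite !tliftD // addrC. Qed.
Lemma tensor_add0 : left_id tensor_zero tensor_add.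
Proof. by move=> t; apply: tensor_ext => M f bf; rewrite tliftD // tlift0 // add0r. Qed.
Lemma tensor_addN : left_inverse tensor_zero tensor_opp tensor_add.
Proof.
by move=> t; apply: tensor_ext => M f bf; rewrite tliftD // tliftN // tlift0 // addNr.
Qed.

HB.instance Definition _ :=
  GRing.isZmodule.Build tensor tensor_addA tensor_addC tensor_add0 tensor_addN.

Lemma tensor_scaleA r s t :
  tensor_scale r (tensor_scale s t) = tensor_scale (r * s) t.
Proof.
apply: tensor_ext => M f bf; rewrite !tliftZ //; last exact: balancedZ.
by apply: eq_tensor_lift => a b; rewrite scalerA.
Qed.
Lemma tensor_scale1 : left_id 1 tensor_scale.
Proof.
move=> t; apply: tensor_ext => M f bf; rewrite tliftZ //.
by apply: eq_tensor_lift => a b; rewrite scale1r.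
Qed.
Lemma tensor_scaleDr : right_distributive tensor_scale +%R.
Proof.
move=> r t u; apply: tensor_ext => M f bf.
by rewrite tliftZ // !tliftD ?tliftZ //; exact: balancedZ.
Qed.
Lemma tensor_scaleDl t : {morph tensor_scale^~ t : r s / r + s}.
Proof.
move=> r s; apply: tensor_ext => M f bf; rewrite tliftD // !tliftZ //.
rewrite /tensor_lift /tensor_eval -big_split; apply: eq_bigr => p _.
by rewrite scalerDl balDl.
Qed.

HB.instance Definition _ := GRing.Zmodule_isLmodule.Build R tensor
  tensor_scaleA tensor_scale1 tensor_scaleDr tensor_scaleDl.

Lemma tensor_mulA : associative tensor_mul.
Proof.
move=> t u v; apply: tensor_ext => M f bf; rewrite !tliftM //; last first.
  exact: balancedMr.
apply: eq_tensor_lift => a b; rewrite tliftM; last exact: balancedMl.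
apply: eq_tensor_lift => a' b'; apply: eq_tensor_lift => a'' b''.
by rewrite !amulA.
Qed.
Lemma tensor_mulDl : left_distributive tensor_mul +%R.
Proof.
move=> t u v; apply: tensor_ext => M f bf.
by rewrite tliftM // !tliftD ?tliftM //; exact: balancedMr.
Qed.
Lemma tensor_mulDr : right_distributive tensor_mul +%R.
Proof.
move=> t u v; apply: tensor_ext => M f bf; rewrite tliftM // tliftD // !tliftM //.
rewrite {1 3 5}/tensor_lift /tensor_eval -big_split; apply: eq_bigr => p _.
by rewrite tliftD //; exact: balancedMl.
Qed.
Lemma tensor_scaleAl (r : R) (t u : tensor) :
  r *: tensor_mul t u = tensor_mul (r *: t) u.
Proof.
apply: tensor_ext => M f bf; rewrite tliftZ // !tliftM //; last first.
  exact: balancedZ.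
rewrite tliftZ; last exact: balancedMr.
by apply: eq_tensor_lift => a b; apply: eq_tensor_lift => c d; rewrite ascaleAl.
Qed.
Lemma tensor_scaleAr (r : R) (t u : tensor) :
  r *: tensor_mul t u = tensor_mul t (r *: u).
Proof.
apply: tensor_ext => M f bf; rewrite tliftZ // !tliftM //; last first.
  exact: balancedZ.
apply: eq_tensor_lift => a b; rewrite tliftZ; last exact: balancedMl.
by apply: eq_tensor_lift => c d; rewrite ascaleAr.
Qed.
Lemma tensor_starK : involutive tensor_star.
Proof.
move=> t; apply: tensor_ext => M f bf; rewrite !tliftS //; last first.
  exact: balancedS.
by apply: eq_tensor_lift => a b; rewrite !astarK.
Qed.
Lemma tensor_starM t u :
  tensor_star (tensor_mul t u) = tensor_mul (tensor_star u) (tensor_star t).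
Proof.
apply: tensor_ext => M f bf; rewrite tliftS // !tliftM //; last first.
  exact: balancedS.
rewrite tliftS; last exact: balancedMr.
transitivity (tensor_lift (fun c d =>
    tensor_lift (fun a b => f (c^* ** a^* ) (d^* ** b^* )) t) u).
  rewrite /tensor_lift /tensor_eval exchange_big; apply: eq_bigr => p _.
  by apply: eq_bigr => q _; rewrite !astarM.
by apply: eq_tensor_lift => c d; rewrite tliftS //; exact: balancedMl.
Qed.
Lemma tensor_starP (r : R) (t u : tensor) :
  tensor_star (r *: t + u) = rstar r *: tensor_star t + tensor_star u.
Proof.
apply: tensor_ext => M f bf.
rewrite tliftS // !tliftD ?tliftS //; last exact: balancedS.
rewrite !tliftZ // ?tliftS //; do ?exact: balancedS; do ?exact: balancedZ.
by congr (_ + _); apply: eq_tensor_lift => a b; rewrite astarZ.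
Qed.

HB.instance Definition _ := isStarAlg.Build R tensor tensor_mulA tensor_mulDl
  tensor_mulDr tensor_scaleAl tensor_scaleAr tensor_starK tensor_starM
  tensor_starP.

Lemma tens_balanced : balanced tens.
Proof.
split=> *; apply: tensor_ext => M f bf.
- by rewrite tliftD // !tensor_lift_tens // balDl.
- by rewrite tliftD // !tensor_lift_tens // balDr.
- by rewrite !tensor_lift_tens // balZ.
Qed.

Lemma tensZ (r : R) a b : tens (r *: a) b = r *: tens a b.
Proof.
apply: tensor_ext => M f bf; rewrite tliftZ // !tensor_lift_tens //.
exact: balancedZ.
Qed.

Lemma tensM a b c d : tens a b ** tens c d = tens (a ** c) (b ** d).
Proof.
apply: tensor_ext => M f bf; rewrite tliftM // !tensor_lift_tens //.
  exact: balancedMl.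
exact: balancedMr.
Qed.

Lemma tensS a b : (tens a b)^* = tens a^* b^*.
Proof.
apply: tensor_ext => M f bf; rewrite tliftS // !tensor_lift_tens //.
exact: balancedS.
Qed.

Lemma tensor_sum_tens (t : tensor) : t = \sum_(p <- repr t) tens p.1 p.2.
Proof.
have h s : \pi_tensor s = \sum_(p <- s) tens p.1 p.2.
  elim: s => [|[a b] s IHs]; first by rewrite big_nil.
  rewrite big_cons -IHs; apply: tensor_ext => M f bf.
  by rewrite tliftD // tensor_lift_tens // !tensor_liftE // big_cons.
by rewrite -h reprK.
Qed.

End Tensor.

Section DirectSum.
Variables (R : starRingType) (I : Type) (A : I -> starAlgType R).

Record dirsum : Type := DirSum {
  ds_val :> forall i, A i;
  ds_fin : finite_set [set i | ds_val i <> 0]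
}.

HB.instance Definition _ := gen_eqMixin dirsum.
HB.instance Definition _ := gen_choiceMixin dirsum.

Lemma dirsum_ext (x y : dirsum) : (forall i, x i = y i) -> x = y.
Proof.
case: x y => [x hx] [y hy] /= xy; have {}xy : x = y by exact: functional_extensionality_dep.
by case: _ / xy in hy *; congr DirSum; exact: Prop_irrelevance.
Qed.

Lemma ds_fin0 : finite_set [set i | (0 : A i) <> 0].
Proof. by apply: (sub_finite_set _ (finite_set0 I)) => i /=. Qed.
Lemma ds_finU (x y : dirsum) (z : forall i, A i) :
  (forall i, x i = 0 -> y i = 0 -> z i = 0) -> finite_set [set i | z i <> 0].
Proof.
move=> xyz; apply: (@sub_finite_set _ _ ([set i | x i <> 0] `|` [set i | y i <> 0])).
  move=> i /= zi; have [x0|] := pselect (x i = 0); last by left.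
  by right=> y0; apply: zi; exact: xyz.
by rewrite finite_setU; split; exact: ds_fin.
Qed.

Definition ds_zero : dirsum := DirSum ds_fin0.
Definition ds_add (x y : dirsum) : dirsum.
Proof.
exists (fun i => x i + y i).
by apply: (@ds_finU x y) => i -> ->; rewrite addr0.
Defined.
Definition ds_opp (x : dirsum) : dirsum.
Proof. by exists (fun i => - x i); apply: (@ds_finU x x) => i ->; rewrite oppr0. Defined.
Definition ds_scale (r : R) (x : dirsum) : dirsum.
Proof.
by exists (fun i => r *: x i); apply: (@ds_finU x x) => i ->; rewrite scaler0.
Defined.
Definition ds_mul (x y : dirsum) : dirsum.
Proof.
exists (fun i => x i ** y i).
by apply: (@ds_finU x y) => i ->; rewrite amul0r.
Defined.
Definition ds_star (x : dirsum) : dirsum.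
Proof. by exists (fun i => (x i)^* ); apply: (@ds_finU x x) => i ->; rewrite astar0. Defined.

Lemma ds_addA : associative ds_add.
Proof. by move=> x y z; apply: dirsum_ext => i /=; rewrite addrA. Qed.
Lemma ds_addC : commutative ds_add.
Proof. by move=> x y; apply: dirsum_ext => i /=; rewrite addrC. Qed.
Lemma ds_add0 : left_id ds_zero ds_add.
Proof. by move=> x; apply: dirsum_ext => i /=; rewrite add0r. Qed.
Lemma ds_addN : left_inverse ds_zero ds_opp ds_add.
Proof. by move=> x; apply: dirsum_ext => i /=; rewrite addNr. Qed.

HB.instance Definition _ :=
  GRing.isZmodule.Build dirsum ds_addA ds_addC ds_add0 ds_addN.

Lemma ds_scaleA r s x : ds_scale r (ds_scale s x) = ds_scale (r * s) x.
Proof. by apply: dirsum_ext => i /=; rewrite scalerA. Qed.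
Lemma ds_scale1 : left_id 1 ds_scale.
Proof. by move=> x; apply: dirsum_ext => i /=; rewrite scale1r. Qed.
Lemma ds_scaleDr : right_distributive ds_scale +%R.
Proof. by move=> r x y; apply: dirsum_ext => i /=; rewrite scalerDr. Qed.
Lemma ds_scaleDl x : {morph ds_scale^~ x : r s / r + s}.
Proof. by move=> r s; apply: dirsum_ext => i /=; rewrite scalerDl. Qed.

HB.instance Definition _ := GRing.Zmodule_isLmodule.Build R dirsum
  ds_scaleA ds_scale1 ds_scaleDr ds_scaleDl.

Lemma ds_mulA : associative ds_mul.
Proof. by move=> x y z; apply: dirsum_ext => i /=; rewrite amulA. Qed.
Lemma ds_mulDl : left_distributive ds_mul +%R.
Proof. by move=> x y z; apply: dirsum_ext => i /=; rewrite amulDl. Qed.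
Lemma ds_mulDr : right_distributive ds_mul +%R.
Proof. by move=> x y z; apply: dirsum_ext => i /=; rewrite amulDr. Qed.
Lemma ds_scaleAl (r : R) (x y : dirsum) : r *: ds_mul x y = ds_mul (r *: x) y.
Proof. by apply: dirsum_ext => i /=; rewrite ascaleAl. Qed.
Lemma ds_scaleAr (r : R) (x y : dirsum) : r *: ds_mul x y = ds_mul x (r *: y).
Proof. by apply: dirsum_ext => i /=; rewrite ascaleAr. Qed.
Lemma ds_starK : involutive ds_star.
Proof. by move=> x; apply: dirsum_ext => i /=; rewrite astarK. Qed.
Lemma ds_starM x y : ds_star (ds_mul x y) = ds_mul (ds_star y) (ds_star x).
Proof. by apply: dirsum_ext => i /=; rewrite astarM. Qed.
Lemma ds_starP (r : R) (x y : dirsum) :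
  ds_star (r *: x + y) = rstar r *: ds_star x + ds_star y.
Proof. by apply: dirsum_ext => i /=; rewrite astarP. Qed.

HB.instance Definition _ := isStarAlg.Build R dirsum ds_mulA ds_mulDl
  ds_mulDr ds_scaleAl ds_scaleAr ds_starK ds_starM ds_starP.

End DirectSum.

Record starSubalg (R : starRingType) (A : starAlgType R) := StarSubalg {
  sub_carrier : set A;
  sub_lin : forall (r : R) a b,
    sub_carrier a -> sub_carrier b -> sub_carrier (r *: a + b);
  sub_0 : sub_carrier 0;
  sub_mul : forall a b, sub_carrier a -> sub_carrier b -> sub_carrier (a ** b);
  sub_star : forall a, sub_carrier a -> sub_carrier a^*
}.

Section Subalgebra.
Variables (R : starRingType) (A : starAlgType R) (S : starSubalg A).

Record subalg : Type := Subalg { subalg_val :> A; subalg_in : sub_carrier S subalg_val }.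

HB.instance Definition _ := gen_eqMixin subalg.
HB.instance Definition _ := gen_choiceMixin subalg.

Lemma subalg_ext (x y : subalg) : x = y :> A -> x = y.
Proof.
case: x y => [x hx] [y hy] /= xy; case: _ / xy in hy *.
by congr Subalg; exact: Prop_irrelevance.
Qed.

Let sub_add a b : sub_carrier S a -> sub_carrier S b -> sub_carrier S (a + b).
Proof. by rewrite -{2}[a]scale1r; exact: sub_lin. Qed.
Let sub_scale (r : R) a : sub_carrier S a -> sub_carrier S (r *: a).
Proof. by move=> Sa; rewrite -[r *: a]addr0; apply: sub_lin => //; exact: sub_0. Qed.
Let sub_opp a : sub_carrier S a -> sub_carrier S (- a).
Proof. by rewrite -scaleN1r; exact: sub_scale. Qed.

Definition sa_zero : subalg := Subalg (sub_0 S).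
Definition sa_add (x y : subalg) : subalg :=
  Subalg (sub_add (subalg_in x) (subalg_in y)).
Definition sa_opp (x : subalg) : subalg := Subalg (sub_opp (subalg_in x)).
Definition sa_scale (r : R) (x : subalg) : subalg :=
  Subalg (sub_scale r (subalg_in x)).
Definition sa_mul (x y : subalg) : subalg :=
  Subalg (sub_mul (subalg_in x) (subalg_in y)).
Definition sa_star (x : subalg) : subalg := Subalg (sub_star (subalg_in x)).

Lemma sa_addA : associative sa_add.
Proof. by move=> x y z; apply: subalg_ext => /=; rewrite addrA. Qed.
Lemma sa_addC : commutative sa_add.
Proof. by move=> x y; apply: subalg_ext => /=; rewrite addrC. Qed.
Lemma sa_add0 : left_id sa_zero sa_add.
Proof. by move=> x; apply: subalg_ext => /=; rewrite add0r. Qed.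
Lemma sa_addN : left_inverse sa_zero sa_opp sa_add.
Proof. by move=> x; apply: subalg_ext => /=; rewrite addNr. Qed.

HB.instance Definition _ :=
  GRing.isZmodule.Build subalg sa_addA sa_addC sa_add0 sa_addN.

Lemma sa_scaleA r s x : sa_scale r (sa_scale s x) = sa_scale (r * s) x.
Proof. by apply: subalg_ext => /=; rewrite scalerA. Qed.
Lemma sa_scale1 : left_id 1 sa_scale.
Proof. by move=> x; apply: subalg_ext => /=; rewrite scale1r. Qed.
Lemma sa_scaleDr : right_distributive sa_scale +%R.
Proof. by move=> r x y; apply: subalg_ext => /=; rewrite scalerDr. Qed.
Lemma sa_scaleDl x : {morph sa_scale^~ x : r s / r + s}.
Proof. by move=> r s; apply: subalg_ext => /=; rewrite scalerDl. Qed.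

HB.instance Definition _ := GRing.Zmodule_isLmodule.Build R subalg
  sa_scaleA sa_scale1 sa_scaleDr sa_scaleDl.

Lemma sa_mulA : associative sa_mul.
Proof. by move=> x y z; apply: subalg_ext => /=; rewrite amulA. Qed.
Lemma sa_mulDl : left_distributive sa_mul +%R.
Proof. by move=> x y z; apply: subalg_ext => /=; rewrite amulDl. Qed.
Lemma sa_mulDr : right_distributive sa_mul +%R.
Proof. by move=> x y z; apply: subalg_ext => /=; rewrite amulDr. Qed.
Lemma sa_scaleAl (r : R) (x y : subalg) : r *: sa_mul x y = sa_mul (r *: x) y.
Proof. by apply: subalg_ext => /=; rewrite ascaleAl. Qed.
Lemma sa_scaleAr (r : R) (x y : subalg) : r *: sa_mul x y = sa_mul x (r *: y).
Proof. by apply: subalg_ext => /=; rewrite ascaleAr. Qed.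
Lemma sa_starK : involutive sa_star.
Proof. by move=> x; apply: subalg_ext => /=; rewrite astarK. Qed.
Lemma sa_starM x y : sa_star (sa_mul x y) = sa_mul (sa_star y) (sa_star x).
Proof. by apply: subalg_ext => /=; rewrite astarM. Qed.
Lemma sa_starP (r : R) (x y : subalg) :
  sa_star (r *: x + y) = rstar r *: sa_star x + sa_star y.
Proof. by apply: subalg_ext => /=; rewrite astarP. Qed.

HB.instance Definition _ := isStarAlg.Build R subalg sa_mulA sa_mulDl
  sa_mulDr sa_scaleAl sa_scaleAr sa_starK sa_starM sa_starP.

End Subalgebra.

Definition span (R : pzRingType) (A : lmodType R) (S : set A) : set A :=
  [set x | exists (n : nat) (r : 'I_n -> R) (a : 'I_n -> A),
     (forall i, S (a i)) /\ x = \sum_(i < n) r i *: a i].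

Section Span.
Variables (R : starRingType) (A : starAlgType R) (S : set A).

Lemma span0 : span S 0.
Proof.
by exists 0%N, (fun=> 0), (fun=> 0); split=> [[]//|]; rewrite big_ord0.
Qed.

Lemma span_cons (r : R) a b : S a -> span S b -> span S (r *: a + b).
Proof.
move=> Sa [n [q [c [Sc ->]]]].
exists n.+1, (fun i => oapp q r (unlift ord0 i)), (fun i => oapp c a (unlift ord0 i)).
split; first by move=> i; case: (unlift ord0 i) => [j|] /=; [exact: Sc|].
rewrite big_ord_recl unlift_none /=; congr (_ + _).
by apply: eq_bigr => i _; rewrite liftK.
Qed.

Lemma span_ind (Q : A -> Prop) : Q 0 ->
  (forall r a b, S a -> Q b -> Q (r *: a + b)) -> forall b, span S b -> Q b.
Proof.
move=> Q0 QD b [n [r [a [Sa ->]]]].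
elim: n r a Sa => [|n IHn] r a Sa; first by rewrite big_ord0.
by rewrite big_ord_recl; apply: QD => //; apply: IHn.
Qed.

Lemma span_gen a : S a -> span S a.
Proof.
move=> Sa; rewrite -[a]addr0 -[a]scale1r; apply: span_cons => //.
exact: span0.
Qed.

Lemma span_lin (r : R) a b : span S a -> span S b -> span S (r *: a + b).
Proof.
move=> + Sb; move: a; apply: span_ind => [|q c d Sc IH].
  by rewrite scaler0 add0r.
by rewrite scalerDr scalerA -addrA; exact: span_cons.
Qed.

Hypothesis SM : forall a b, S a -> S b -> span S (a ** b).
Hypothesis SS : forall a, S a -> span S a^*.

Lemma span_mul a b : span S a -> span S b -> span S (a ** b).
Proof.
move=> + Sb; move: a; apply: span_ind => [|r c d Sc IH].
  by rewrite amul0r; exact: span0.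
rewrite amulDl -ascaleAl; apply: span_lin => {IH}//.
move: b Sb; apply: span_ind => [|q b e Sb IH].
  by rewrite amulr0; exact: span0.
by rewrite amulDr -ascaleAr; apply: span_lin => //; exact: SM.
Qed.

Lemma span_star a : span S a -> span S a^*.
Proof.
move: a; apply: span_ind => [|r c d Sc IH]; first by rewrite astar0; exact: span0.
by rewrite astarP; apply: span_lin => //; exact: SS.
Qed.

Definition span_subalg : starSubalg A :=
  StarSubalg span_lin span0 span_mul span_star.

End Span.

Record digraph := Digraph {
  vert : countType;
  edge : countType;
  rng : edge -> vert;
  src : edge -> vert
}.

Definition edges_into (E : digraph) (v : vert E) : set (edge E) :=
  [set e | rng e = v].

Definition finite_graph (E : digraph) : Prop :=
  finite_set [set: vert E] /\ finite_set [set: edge E].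

(* The action on $E^0 \sqcup E^1$ is given by its restrictions to each part. *)
Record self_similar (G : groupType) (E : digraph) := SelfSimilar {
  ss_countable : countable [set: G];
  ss_row_finite : forall v : vert E, finite_set (edges_into v);
  ss_no_sources : forall v : vert E, edges_into v !=set0;
  actv : G -> vert E -> vert E;
  acte : G -> edge E -> edge E;
  actv1 : forall v, actv 1%g v = v;
  actvM : forall g h v, actv (g * h)%g v = actv g (actv h v);
  acte1 : forall e, acte 1%g e = e;
  acteM : forall g h e, acte (g * h)%g e = acte g (acte h e);
  act_rng : forall g e, rng (acte g e) = actv g (rng e);
  act_src : forall g e, src (acte g e) = actv g (src e);
  cocycle : G -> edge E -> G;
  cocycleM : forall g h e,
    cocycle (g * h)%g e = (cocycle g (acte h e) * cocycle h e)%g;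
  cocycle_act : forall g e v, actv (cocycle g e) v = actv g v
}.

(* The sum in [ef_sum] is over a finite set when [E] is row-finite; over an   *)
(* infinite set, [\sum_(_ \in _)] only adds up finitely supported families. *)
Record E_family (R : starRingType) (E : digraph) (A : starAlgType R)
    (P : vert E -> A) (S : edge E -> A) : Prop := EFamily {
  ef_proj : forall v, projection (P v);
  ef_orth : forall v w, v <> w -> P v ** P w = 0;
  ef_piso : forall e, partial_isometry (S e);
  ef_starS : forall e f, (S e)^* ** S f = if e == f then P (src e) else 0;
  ef_sum : forall v, P v = \sum_(e \in edges_into v) (S e ** (S e)^* )
}.

Section GEFamily.
Variables (R : starRingType) (G : groupType) (E : digraph).
Variable T : self_similar G E.

Record GE_family (A : starAlgType R)
    (P : vert E -> G -> A) (S : edge E -> G -> A) : Prop := GEFamily {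
  ge_E : E_family (fun v => P v 1%g) (fun e => S e 1%g);
  ge_starP : forall v f, (P v f)^* = P (actv T f^-1%g v) f^-1%g;
  ge_PP : forall v f w h,
    P v f ** P w h = if v == actv T f w then P v (f * h)%g else 0;
  ge_PS : forall v f e g,
    P v f ** S e g =
      if v == rng (acte T f e) then S (acte T f e) (cocycle T f e * g)%g else 0;
  ge_SP : forall e g v f,
    S e g ** P v f = if actv T g v == src e then S e (g * f)%g else 0
}.

Definition GE_gens (A : starAlgType R)
    (x : (vert E * G) + (edge E * G) -> A) : Prop :=
  GE_family (fun v f => x (inl (v, f))) (fun e g => x (inr (e, g))).

Definition LGE : starAlgType R := univ_alg GE_gens.

Definition p_ (v : vert E) (f : G) : LGE := univ_gen GE_gens (inl (v, f)).
Definition s_ (e : edge E) (g : G) : LGE := univ_gen GE_gens (inr (e, g)).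

Lemma LGE_family : GE_family p_ s_.
Proof.
have lift0 (A : starAlgType R) x (Px : @GE_gens A x) :
    univ_lift x (0 : LGE) = 0.
  exact: star_hom0 (univ_lift_hom Px).
split; first split.
- move=> v; split; apply: univ_ext => A x Px; have h := univ_lift_hom Px.
    by rewrite (star_homS h) univ_lift_gen // -(ef_proj (ge_E Px) v).1.
  by rewrite (star_homM h) univ_lift_gen // -(ef_proj (ge_E Px) v).2.
- move=> v w vw; apply: univ_ext => A x Px; have h := univ_lift_hom Px.
  by rewrite (star_homM h) !univ_lift_gen // lift0 // (ef_orth (ge_E Px)).
- move=> e; apply: univ_ext => A x Px; have h := univ_lift_hom Px.
  rewrite !(star_homM h, star_homS h) univ_lift_gen //.
  exact: (ef_piso (ge_E Px)).
- move=> e f; apply: univ_ext => A x Px; have h := univ_lift_hom Px.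
  rewrite !(star_homM h, star_homS h) !univ_lift_gen // (ef_starS (ge_E Px)).
  by case: eqP => _; rewrite ?univ_lift_gen ?lift0.
- move=> v; apply: univ_ext => A x Px; have h := univ_lift_hom Px.
  rewrite univ_lift_gen // (ef_sum (ge_E Px)) !fsbig_finite; try exact: ss_row_finite T v.
  rewrite (big_morph _ (star_homD h) (lift0 _ _ Px)); apply: eq_bigr => e _.
  by rewrite (star_homM h) (star_homS h) univ_lift_gen.
- move=> v f; apply: univ_ext => A x Px; have h := univ_lift_hom Px.
  by rewrite (star_homS h) !univ_lift_gen // (ge_starP Px).
- move=> v f w k; apply: univ_ext => A x Px; have h := univ_lift_hom Px.
  rewrite (star_homM h) !univ_lift_gen // (ge_PP Px).
  by case: eqP => _; rewrite ?univ_lift_gen ?lift0.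
- move=> v f e g; apply: univ_ext => A x Px; have h := univ_lift_hom Px.
  rewrite (star_homM h) !univ_lift_gen // (ge_PS Px).
  by case: eqP => _; rewrite ?univ_lift_gen ?lift0.
- move=> e g v f; apply: univ_ext => A x Px; have h := univ_lift_hom Px.
  rewrite (star_homM h) !univ_lift_gen // (ge_SP Px).
  by case: eqP => _; rewrite ?univ_lift_gen ?lift0.
Qed.

Definition D_gens : set LGE := [set a | exists v f, a = p_ v f].

Lemma D_gensM a b : D_gens a -> D_gens b -> span D_gens (a ** b).
Proof.
move=> [v [f ->]] [w [h ->]]; rewrite (ge_PP LGE_family); case: eqP => _.
  by apply: span_gen; exists v, (f * h)%g.
exact: span0.
Qed.

Lemma D_gensS a : D_gens a -> span D_gens a^*.
Proof.
move=> [v [f ->]]; rewrite (ge_starP LGE_family).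
by apply: span_gen; exists (actv T f^-1%g v), f^-1%g.
Qed.

Definition D_alg : starSubalg LGE := span_subalg D_gensM D_gensS.

Lemma actv_inj g : injective (actv T g).
Proof. by apply: (can_inj (g := actv T g^-1%g)) => v; rewrite -actvM mulVg actv1. Qed.

Definition vorbit (v : vert E) : set (vert E) := range (fun g => actv T g v).

Definition stab (v : vert E) : set G := [set g | actv T g v = v].

Lemma orbit_finite (V : set (vert E)) :
  finite_graph E \/ (forall v, V v -> finite_set (vorbit v)) ->
  forall v : V, finite_set (vorbit (val v)).
Proof.
move=> [[fV _]|h] v; first by apply: sub_finite_set fV.
by apply: h; exact: set_valP.
Qed.

Record orbit_section (v : vert E) := OrbitSection {
  sec :> vert E -> G;
  sec1 : sec v = 1%g;
  secP : forall w, vorbit v w -> actv T (sec w) v = w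
}.

Section Wv.
Variables (v : vert E) (gw : orbit_section v).

Definition e_ (w : vert E) (g : G) : LGE :=
  p_ w (gw w) ** p_ v g ** (p_ w (gw w))^*.

Definition W_ (g : G) : LGE := \sum_(w \in vorbit v) e_ w g.

Definition W_gens : set LGE := [set a | exists2 g, stab v g & a = W_ g].

Hypothesis fin : finite_set (vorbit v).

Lemma secV w : vorbit v w -> actv T (gw w)^-1%g w = v.
Proof.
by move=> vw; apply: (@actv_inj (gw w)); rewrite -actvM mulgV actv1 secP.
Qed.

Lemma e_E w g : vorbit v w -> stab v g ->
  e_ w g = p_ w (gw w * g * (gw w)^-1)%g.
Proof.
move=> vw sg; have gwv := secP gw vw.
have gwV : actv T (gw w)^-1%g w = v 
  by apply: (@actv_inj (gw w)); rewrite -actvM mulgV actv1 gwv.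
rewrite /e_ (ge_starP LGE_family) gwV !(ge_PP LGE_family) gwv eqxx.
by rewrite (ge_PP LGE_family) actvM sg gwv eqxx.
Qed.

Lemma eM w w' g h : vorbit v w -> vorbit v w' -> stab v g -> stab v h ->
  e_ w g ** e_ w' h = if w == w' then e_ w (g * h)%g else 0.
Proof.
move=> vw vw' sg sh; rewrite (e_E vw sg) (e_E vw' sh) (ge_PP LGE_family).
have st : actv T (gw w * g * (gw w)^-1)%g w = w.
  by rewrite !actvM secV // sg secP.
have inj : (w == actv T (gw w * g * (gw w)^-1)%g w') = (w == w').
  apply/eqP/eqP => [h'|<-]; last by rewrite st.
  by apply: (@actv_inj (gw w * g * (gw w)^-1)%g); rewrite st.
rewrite inj; case: eqP => // <-; rewrite e_E //; last by rewrite /stab /= actvM sh sg.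
by congr (p_ _ _); rewrite !mulgA mulgVK.
Qed.

Lemma eS w g : vorbit v w -> stab v g -> (e_ w g)^* = e_ w g^-1%g.
Proof.
move=> vw sg; have sV : stab v g^-1%g.
  by rewrite /stab /= -{1}sg -actvM mulVg actv1.
rewrite (e_E vw sg) (e_E vw sV) (ge_starP LGE_family) !invgM invgK mulgA.
congr (p_ _ _).
by rewrite !actvM secV // sV secP.
Qed.

Lemma W_gensM a b : W_gens a -> W_gens b -> span W_gens (a ** b).
Proof.
move=> [g sg ->] [h sh ->]; apply: span_gen; exists (g * h)%g.
  by rewrite /stab /= actvM sh sg.
rewrite /W_ !fsbig_finite //.
have inO w : w \in fset_set (vorbit v) -> vorbit v w.
  by rewrite in_fset_set // => /set_mem.
transitivity (\sum_(w <- fset_set (vorbit v)) \sum_(w' <- fset_set (vorbit v))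
    (e_ w g ** e_ w' h)).
  have Ml (x : LGE) : {morph (fun y : LGE => y ** x) : y z / y + z}.
    by move=> y z; rewrite amulDl.
  have Mr (x : LGE) : {morph (fun y : LGE => x ** y) : y z / y + z}.
    by move=> y z; rewrite amulDr.
  rewrite (big_morph _ (Ml _) (amul0r _)); apply: eq_bigr => w _.
  by rewrite (big_morph _ (Mr _) (amulr0 _)).
rewrite big_seq [RHS]big_seq; apply: eq_bigr => w wO.
rewrite (big_rem w) //= eM ?eqxx; try by [|exact: inO].
rewrite big_seq big1 ?addr0 // => w'.
rewrite mem_rem_uniq ?fset_uniq // => /andP[/= w'w w'O].
by rewrite eM; try by [|exact: inO]; rewrite eq_sym (negPf w'w).
Qed.

Lemma W_gensS a : W_gens a -> span W_gens a^*.
Proof.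
move=> [g sg ->]; apply: span_gen; exists g^-1%g.
  by rewrite /stab /= -{1}sg -actvM mulVg actv1.
rewrite /W_ !fsbig_finite // (big_morph _ (@astarD _ LGE) (astar0)).
rewrite big_seq [RHS]big_seq; apply: eq_bigr => w.
by rewrite in_fset_set // => /set_mem wO; rewrite eS.
Qed.

Definition W_alg : starSubalg LGE := span_subalg W_gensM W_gensS.

End Wv.
End GEFamily.

(* Main.v *)
Require Import Defs.
From mathcomp Require Import all_boot ssralg finmap all_classical.

(* Fix v in V and put q_x = p_{x,g_x} for x in the orbit X of v, so that
   q_x^* q_y = delta_{x,y} p_v and q_x q_x^* = p_x. For a in D the corner
   q_x^* a q_y is spread over the orbit to c_{x,y}(a) = sum_w q_w q_x^* a q_y q_w^*,
   an element of W_v, and the v-component of the isomorphism is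
   a |-> sum_{x,y} eta_{x,y} (x) c_{x,y}(a).  Multiplicativity comes from
   q_x^* a = sum_y q_x^* a q_y q_y^* on D.  Since the p_{z,h} may be linearly
   dependent, no basis of D is used: injectivity follows by mapping
   eta_{x,y} (x) w back to q_x q_y^* w, which recovers p_x a for all x. *)

Set Implicit Arguments.
Unset Strict Implicit.
Unset Printing Implicit Defensive.

Import GRing.Theory.
Local Open Scope classical_set_scope.
Local Open Scope ring_scope.

(** * Finite sums in star-algebras and in tensor products *)

Lemma sum_seq_single (M : nmodType) (I : eqType) (s : seq I) (i : I)
    (F : I -> M) :
  uniq s -> i \in s -> (forall j, j != i -> F j = 0) ->
  \sum_(j <- s) F j = F i.
Proof. by move=> us si F0; rewrite (bigD1_seq i) //= big1 ?addr0. Qed.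

Section StarAlgebraSums.
Context {R : starRingType}.

Lemma amul_suml (A : starAlgType R) I (s : seq I) (F : I -> A) (b : A) :
  (\sum_(i <- s) F i) ** b = \sum_(i <- s) F i ** b.
Proof.
by apply: (big_morph (fun y : A => y ** b)) => [y z|]; rewrite (amulDl, amul0r).
Qed.

Lemma amul_sumr (A : starAlgType R) I (s : seq I) (F : I -> A) (b : A) :
  b ** (\sum_(i <- s) F i) = \sum_(i <- s) b ** F i.
Proof.
by apply: (big_morph (fun y : A => b ** y)) => [y z|]; rewrite (amulDr, amulr0).
Qed.

Lemma astar_sum (A : starAlgType R) I (s : seq I) (F : I -> A) :
  (\sum_(i <- s) F i)^* = \sum_(i <- s) (F i)^*.
Proof. by apply: big_morph => [y z|]; rewrite (astarD, astar0). Qed.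

Lemma amulZl (A : starAlgType R) (r : R) (a b : A) :
  (r *: a) ** b = r *: (a ** b).
Proof. by rewrite ascaleAl. Qed.

Lemma amulZr (A : starAlgType R) (r : R) (a b : A) :
  a ** (r *: b) = r *: (a ** b).
Proof. by rewrite ascaleAr. Qed.

Lemma subalg_val_sum (A : starAlgType R) (S : starSubalg A) I (s : seq I)
    (F : I -> subalg S) :
  (\sum_(i <- s) F i : subalg S) = \sum_(i <- s) (F i : A) :> A.
Proof. by apply: (big_morph (@subalg_val R A S)). Qed.

Lemma tens0l (A B : starAlgType R) (b : B) : tens (0 : A) b = 0.
Proof. by rewrite -(scale0r (0 : A)) tensZ scale0r. Qed.

Lemma tensDr (A B : starAlgType R) (a : A) (b b' : B) :
  tens a (b + b') = tens a b + tens a b'.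
Proof. exact: balDr (tens_balanced A B) _ _ _. Qed.

Lemma tensZr (A B : starAlgType R) (r : R) (a : A) (b : B) :
  tens a (r *: b) = r *: tens a b.
Proof. by rewrite -(balZ (tens_balanced A B)) tensZ. Qed.

Lemma tensr0 (A B : starAlgType R) (a : A) : tens a (0 : B) = 0.
Proof. by rewrite -(scale0r (0 : B)) tensZr scale0r. Qed.

Lemma tens_sumr (A B : starAlgType R) I (s : seq I) (a : A) (F : I -> B) :
  tens a (\sum_(i <- s) F i) = \sum_(i <- s) tens a (F i).
Proof.
by apply: (big_morph (tens a)) => [b b'|]; rewrite (tensDr, tensr0).
Qed.

Lemma tensor_lift_sum (A B : starAlgType R) (M : zmodType) (f : A -> B -> M)
    I (s : seq I) (F : I -> tensor A B) :
  balanced f ->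
  tensor_lift f (\sum_(i <- s) F i) = \sum_(i <- s) tensor_lift f (F i).
Proof.
move=> bf; apply: (big_morph (tensor_lift f)) => [t u|]; first exact: tliftD.
exact: tlift0.
Qed.

End StarAlgebraSums.

(* The span of the matrix units contains a copy of them, so the universal
   property yields an endomorphism of [mx_alg] with values in this span that
   fixes every matrix unit, i.e. the identity. *)
Lemma mx_alg_span (R : starRingType) (X : eqType) (m : mx_alg R X) :
  span [set a | exists x y, a = mx_unit R x y] m.
Proof.
set S := (S in span S).
have SM a b : S a -> S b -> span S (a ** b).
  move=> [x [y ->]] [w [z ->]]; rewrite (mx_unitP R X).2; case: eqP => _.
    by apply: span_gen; exists x, z.
  exact: span0.
have SS a : S a -> span S a^*.
  move=> [x [y ->]]; rewrite (mx_unitP R X).1.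
  by apply: span_gen; exists y, x.
have Sg x y : span S (mx_unit R x y) by apply: span_gen; exists x, y.
pose B := span_subalg SM SS.
pose eta xy : subalg B := @Subalg _ _ B _ (Sg xy.1 xy.2).
have Peta : matrix_units eta.
  split=> [x y|x y w z]; apply: subalg_ext => /=.
    exact: (mx_unitP R X).1.
  by rewrite (mx_unitP R X).2; case: eqP.
have [hD hZ hM hS] := univ_lift_hom Peta.
pose f (a : mx_alg R X) : mx_alg R X := subalg_val (univ_lift eta a).
have fh : star_hom f by split=> [a b|r a|a b|a]; rewrite /f ?hD ?hZ ?hM ?hS.
have idh : star_hom (@id (mx_alg R X)) by [].
have f_gen i : f (univ_gen (@matrix_units R X) i) = univ_gen (@matrix_units R X) i.
  by rewrite /f univ_lift_gen //; case: i.
have id_gen i : id (univ_gen (@matrix_units R X) i) = univ_gen (@matrix_units R X) i.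
  by [].
have Pid : matrix_units (univ_gen (@matrix_units R X)) by exact: mx_unitP.
rewrite -[m]/(id m) (univ_lift_unique Pid idh id_gen m).
rewrite -(univ_lift_unique Pid fh f_gen m).
exact: (subalg_in (univ_lift eta m)).
Qed.

(** * A single finite orbit and its partial isometries *)

Section OrbitComponent.
Variables (R : starRingType) (G : groupType) (E : digraph).
Variable T : self_similar G E.
Variables (v : vert E) (gw : orbit_section T v).
Hypothesis fin : finite_set (vorbit T v).

Local Notation X := (vorbit T v).
Local Notation L := (LGE R T).
Local Notation D := (span (@D_gens R G E T)).
Local Notation p := (p_ R T).
Local Notation W := (subalg (W_alg R gw fin)).

(** Enumerates the subtype [X] rather than a part of [vert E], since the matrix units are indexed by
    [X]; [sum_orbit] links it to the sum in [W_]. *)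
Definition orbit_seq : seq X := pmap insub (fset_set X : seq (vert E)).

Lemma orbit_seq_uniq : uniq orbit_seq.
Proof. exact/pmap_sub_uniq/fset_uniq. Qed.

Lemma mem_orbit_seq (x : X) : x \in orbit_seq.
Proof.
rewrite mem_pmap_sub in_fset_set //; exact: mem_set (set_valP x).
Qed.

Lemma sum_orbit (M : nmodType) (F : vert E -> M) :
  \sum_(w \in X) F w = \sum_(x <- orbit_seq) F (val x).
Proof.
rewrite fsbig_finite // -(big_map val xpredT) /orbit_seq.
rewrite (pmap_filter (insubK _)); congr (\sum_(_ <- _) _).
apply/esym/all_filterP/allP => w; rewrite in_fset_set // => wX /=.
by rewrite insubT.
Qed.

Lemma sum_orbit_single (M : nmodType) (x : X) (F : X -> M) :
  (forall y, y != x -> F y = 0) -> \sum_(y <- orbit_seq) F y = F x.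
Proof. exact/sum_seq_single/mem_orbit_seq/orbit_seq_uniq. Qed.

Definition leg (x : X) : L := p (val x) (gw (val x)).
Local Notation q := leg.

Lemma sec_val (x : X) : actv T (gw (val x)) v = val x.
Proof. exact: secP (set_valP x). Qed.

Lemma secV_val (x : X) : actv T (gw (val x))^-1%g (val x) = v.
Proof. exact: secV (set_valP x). Qed.

Lemma leg_star (x : X) : (q x)^* = p v (gw (val x))^-1%g.
Proof. by rewrite (ge_starP (LGE_family R T)) secV_val. Qed.

Lemma actv_eq g (x y : vert E) :
  (x == actv T g y) = (actv T g^-1%g x == y).
Proof.
apply/eqP/eqP => [->|<-]; first by rewrite -actvM mulVg actv1.
by rewrite -actvM mulgV actv1.
Qed.

Lemma leg_orth (x y : X) : (q x)^* ** q y = if x == y then p v 1%g else 0.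
Proof.
rewrite leg_star (ge_PP (LGE_family R T)) actv_eq invgK sec_val.
by rewrite -val_eqE; case: eqP => [->|]; rewrite ?mulVg.
Qed.

Lemma leg_proj (x : X) : q x ** (q x)^* = p (val x) 1%g.
Proof.
by rewrite leg_star (ge_PP (LGE_family R T)) sec_val eqxx mulgV.
Qed.

Lemma leg_unit (x : X) : q x ** p v 1%g = q x.
Proof. by rewrite (ge_PP (LGE_family R T)) sec_val eqxx mulg1. Qed.

Lemma unit_leg (x : X) : p v 1%g ** (q x)^* = (q x)^*.
Proof.
by rewrite leg_star (ge_PP (LGE_family R T)) actv1 eqxx mul1g.
Qed.

Lemma leg_star_proj (x : X) : (q x)^* ** p (val x) 1%g = (q x)^*.
Proof.
by rewrite leg_star (ge_PP (LGE_family R T)) secV_val eqxx mulg1.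
Qed.

(** * Entries of an element and their spreading over the orbit *)

Definition entry (x y : X) (a : L) : L := (q x)^* ** a ** q y.

Definition spread (c : L) : L := \sum_(w <- orbit_seq) q w ** c ** (q w)^*.

Lemma entry_lin x y r a b : entry x y (r *: a + b) = r *: entry x y a + entry x y b.
Proof. by rewrite /entry amulDr amulDl amulZr amulZl. Qed.

Lemma entry_star x y a : entry x y a^* = (entry y x a)^*.
Proof. by rewrite /entry !astarM astarK amulA. Qed.

Lemma leg_star_gen (x : X) z h :
  (q x)^* ** p z h = if val x == z then p v ((gw (val x))^-1 * h)%g else 0.
Proof.
by rewrite leg_star (ge_PP (LGE_family R T)) actv_eq invgK sec_val.
Qed.

(** A generator has at most one nonzero place, in row [z] and column [h^-1 z]. *)
Lemma entry_gen (x y : X) z h :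
  entry x y (p z h) = if (val x == z) && (val y == actv T h^-1%g z) then
    p v ((gw (val x))^-1 * h * gw (val y))%g else 0.
Proof.
rewrite /entry leg_star_gen; case: eqP => [<-|] /=; last by rewrite amul0r.
rewrite (ge_PP (LGE_family R T)) actvM actv_eq invgK sec_val actv_eq.
by rewrite eq_sym.
Qed.

Lemma spread_lin r a b : spread (r *: a + b) = r *: spread a + spread b.
Proof.
rewrite /spread scaler_sumr -big_split; apply: eq_bigr => w _ /=.
by rewrite amulDr amulDl amulZr amulZl.
Qed.

Lemma spread0 : spread 0 = 0.
Proof. by rewrite /spread big1 // => w _; rewrite amulr0 amul0r. Qed.

Lemma spread_sum I (s : seq I) (F : I -> L) :
  spread (\sum_(i <- s) F i) = \sum_(i <- s) spread (F i).
Proof.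
apply: (big_morph spread _ spread0) => a b.
by rewrite -[a]scale1r spread_lin !scale1r.
Qed.

Lemma spread_star a : spread a^* = (spread a)^*.
Proof.
by rewrite /spread astar_sum; apply: eq_bigr => w _; rewrite !astarM astarK amulA.
Qed.

Lemma leg_spread x c : (q x)^* ** spread c = p v 1%g ** c ** (q x)^*.
Proof.
rewrite /spread amul_sumr (sum_orbit_single (x := x)) => [|y yx].
  by rewrite !amulA leg_orth eqxx.
by rewrite !amulA leg_orth eq_sym (negPf yx) !amul0r.
Qed.

(** Orthogonality of the legs kills the cross terms. The middle [p_v] stays because [c] and [d] are
    arbitrary, not taken in the corner at [v]. *)
Lemma spreadM c d : spread c ** spread d = spread (c ** p v 1%g ** d).
Proof.
rewrite {1}/spread amul_suml; apply: eq_bigr => w _.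
by rewrite -amulA leg_spread !amulA.
Qed.

Lemma spread_W g : spread (p v g) = W_ R gw g.
Proof. by rewrite /W_ sum_orbit. Qed.

(** The product moves [v] to [y], then [y] to [x], then [x] back to [v]. *)
Lemma stab_entry (x y : X) z h : val x = z -> val y = actv T h^-1%g z ->
  stab T v ((gw (val x))^-1 * h * gw (val y))%g.
Proof.
move=> xz yz; rewrite /stab /= !actvM sec_val yz -xz.
by rewrite -(actvM T h) mulgV actv1 secV_val.
Qed.

(** On a generator the entry is zero or some [p_{v,g}] with [g] in the stabilizer, which spreads to
    [W_g]. This lets [coeff] take values in [W]. *)
Lemma spread_entry_in x y a : D a -> span (@W_gens R G E T v gw) (spread (entry x y a)).
Proof.
move: a; apply: span_ind => [|r _ b [z [h ->]] IH].
  by rewrite /entry amulr0 amul0r spread0; exact: span0.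
rewrite entry_lin spread_lin; apply: span_lin => //.
rewrite entry_gen; case: andP => [[/eqP xz /eqP yz]|_]; last first.
  by rewrite spread0; exact: span0.
rewrite spread_W; apply: span_gen; eexists; last by [].
exact: stab_entry yz.
Qed.

(** For a generator at [x] only the column [h^-1 x] contributes, and it lies in the same orbit;
    linearity does the rest. *)
Lemma leg_star_expand x a : D a ->
  (q x)^* ** a = \sum_(y <- orbit_seq) entry x y a ** (q y)^*.
Proof.
move: a; apply: span_ind => [|r _ b [z [h ->]] IH].
  by rewrite amulr0 big1 // => y _; rewrite /entry amulr0 !amul0r.
rewrite amulDr amulZr IH.
under [in RHS]eq_bigr do rewrite entry_lin amulDl amulZl.
rewrite big_split -scaler_sumr; congr (r *: _ + _).
rewrite leg_star_gen; case: eqP => [<-{z}|/eqP/negPf xz]; last first.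
  by rewrite big1 // => y _; rewrite entry_gen xz amul0r.
have yX : actv T h^-1%g (val x) \in X.
  by apply/mem_set; exists (h^-1 * gw (val x))%g => //; rewrite actvM sec_val.
have [y yx] : exists y : X, val y = actv T h^-1%g (val x) by exists (SigSub yX).
rewrite (sum_orbit_single (x := y)) => [|y' y'y]; rewrite entry_gen eqxx /=.
  rewrite yx eqxx leg_star (ge_PP (LGE_family R T)) -yx.
  by rewrite (stab_entry erefl yx) eqxx mulgK.
by rewrite -yx val_eqE (negPf y'y) amul0r.
Qed.

(** * The orbit component as a star-homomorphism, and its kernel *)

Definition coeff (x y : X) (a : subalg (D_alg R T)) : W :=
  @Subalg _ _ (W_alg R gw fin) _ (spread_entry_in x y (subalg_in a)).

Definition orbit_comp (a : subalg (D_alg R T)) : tensor (mx_alg R X) W :=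
  \sum_(x <- orbit_seq) \sum_(y <- orbit_seq) tens (mx_unit R x y) (coeff x y a).

Lemma coeff_lin x y r a b :
  coeff x y (r *: a + b) = r *: coeff x y a + coeff x y b.
Proof. by apply: subalg_ext; rewrite /= entry_lin spread_lin. Qed.

Lemma coeff_star x y a : coeff x y a^* = (coeff y x a)^*.
Proof. by apply: subalg_ext; rewrite /= entry_star spread_star. Qed.

Lemma coeffM x z a b :
  coeff x z (a ** b) = \sum_(y <- orbit_seq) coeff x y a ** coeff y z b.
Proof.
apply: subalg_ext; rewrite subalg_val_sum /=.
under eq_bigr do rewrite spreadM.
rewrite -spread_sum; congr spread.
rewrite {1}/entry amulA (leg_star_expand x (subalg_in a)) !amul_suml.
apply: eq_bigr => y _.
(* [unit_leg] absorbs the [p_v] that [spreadM] leaves between the two entries. *)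
by rewrite [entry y z _]/entry !amulA -[_ ** p v 1%g ** _]amulA unit_leg.
Qed.

Lemma orbit_comp_lin r a b :
  orbit_comp (r *: a + b) = r *: orbit_comp a + orbit_comp b.
Proof.
rewrite /orbit_comp scaler_sumr -big_split; apply: eq_bigr => x _ /=.
rewrite scaler_sumr -big_split; apply: eq_bigr => y _ /=.
by rewrite coeff_lin tensDr tensZr.
Qed.

Lemma orbit_comp_star a : orbit_comp a^* = (orbit_comp a)^*.
Proof.
rewrite /orbit_comp astar_sum; under [RHS]eq_bigr do rewrite astar_sum.
rewrite exchange_big; apply: eq_bigr => y _; apply: eq_bigr => x _.
by rewrite tensS coeff_star (mx_unitP R X).1.
Qed.

Lemma orbit_compM a b : orbit_comp (a ** b) = orbit_comp a ** orbit_comp b.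
Proof.
rewrite /orbit_comp amul_suml; apply: eq_bigr => x _.
rewrite amul_suml; under eq_bigr do rewrite coeffM tens_sumr.
rewrite exchange_big; apply: eq_bigr => y _.
rewrite amul_sumr [RHS](sum_orbit_single (x := y)) => [|y' y'y]; rewrite amul_sumr.
  apply: eq_bigr => z _.
  by rewrite tensM (mx_unitP R X).2 eqxx.
rewrite big1 // => z _; rewrite tensM (mx_unitP R X).2 eq_sym (negPf y'y).
exact: tens0l.
Qed.

(* [eta_xy (x) w |-> q x ** (q y)^* ** w] is a left inverse of [orbit_comp] up
   to multiplication by the projection onto the orbit. *)
Lemma orbit_comp_eq0 a x : orbit_comp a = 0 -> (q x)^* ** subalg_val a = 0.
Proof.
move=> a0; pose eta xy := q xy.1 ** (q xy.2)^*.
have Peta : matrix_units eta.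
  split=> [y z|y z w u]; rewrite /eta /=; first by rewrite astarM astarK.
  rewrite amulA -[q y ** _ ** _]amulA leg_orth; case: eqP => _.
    by rewrite leg_unit.
  by rewrite amulr0 amul0r.
have [hD hZ _ _] := univ_lift_hom Peta.
pose f (m : mx_alg R X) (w : W) : L := univ_lift eta m ** subalg_val w.
have bf : balanced f.
  split=> [m m' w|m w w'|r m w]; rewrite /f.
  - by rewrite hD amulDl.
  - by rewrite -amulDr.
  - by rewrite hZ amulZl -amulZr.
have : tensor_lift f (orbit_comp a) = 0 by rewrite a0 tlift0.
rewrite tensor_lift_sum //.
(* The term at [(x, y)] goes to [q_x q_y^* spread (entry x y a) = q_x (entry x y a) q_y^*], and
   these add up over [y] to [q_x q_x^* a]. *)
have -> : \sum_(x <- orbit_seq) tensor_lift f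
    (\sum_(y <- orbit_seq) tens (mx_unit R x y) (coeff x y a)) =
    \sum_(x <- orbit_seq) q x ** ((q x)^* ** subalg_val a).
  apply: eq_bigr => y _; rewrite tensor_lift_sum //.
  rewrite (leg_star_expand y (subalg_in a)) amul_sumr; apply: eq_bigr => z _.
  rewrite tensor_lift_tens // /f univ_lift_gen //= /eta /= -amulA leg_spread.
  by rewrite !amulA leg_unit.
(* Left multiplication by [q_x^*] isolates the summand at [x]. *)
move/(congr1 (amul (q x)^*)); rewrite amulr0 amul_sumr.
rewrite (sum_orbit_single (x := x)) => [|y yx]; rewrite amulA leg_orth.
  by rewrite eqxx amulA unit_leg.
by rewrite eq_sym (negPf yx) amul0r.
Qed.

(** Converse of [orbit_comp_eq0]: together they describe the kernel by products with the legs. *)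
Lemma orbit_comp_vanish a :
  (forall x, (q x)^* ** subalg_val a = 0) -> orbit_comp a = 0.
Proof.
move=> a0; rewrite /orbit_comp big1 // => x _; rewrite big1 // => y _.
rewrite -[RHS](tensr0 _ (mx_unit R x y)); congr tens; apply: subalg_ext.
by rewrite /= /entry a0 amul0r spread0.
Qed.

(** * Preimages under the orbit component *)

Definition D_gen z h : subalg (D_alg R T) :=
  @Subalg _ _ (D_alg R T) (p z h)
    (span_gen (ex_intro _ z (ex_intro _ h erefl))).

(** The group element carries [y] to [x], so [(x, y)] is the only possible nonzero place, with entry
    [p_{v,h}]. Giving [w] by its underlying value makes the choice of membership proof
    irrelevant. *)
Lemma orbit_comp_gen (x y : X) h (w : W) : stab T v h ->
  subalg_val w = W_ R gw h ->
  orbit_comp (D_gen (val x) (gw (val x) * h * (gw (val y))^-1)%g) =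
    tens (mx_unit R x y) w.
Proof.
move=> sh wE; set k := (_ * _ * _)%g.
have kx : actv T k^-1%g (val x) = val y.
  have shV : actv T h^-1%g v = v by apply/eqP; rewrite -actv_eq sh.
  by rewrite /k !invgM invgK !actvM secV_val shV sec_val.
have coeffE x' y' : coeff x' y' (D_gen (val x) k) =
    if (x' == x) && (y' == y) then w else 0.
  apply: subalg_ext; rewrite /= entry_gen kx !val_eqE.
  case: andP => [[/eqP-> /eqP->]|_]; last by rewrite spread0.
  by rewrite /k !mulgA mulVg mul1g mulgVK spread_W wE.
rewrite /orbit_comp (sum_orbit_single (x := x)) => [|x' x'x].
  rewrite (sum_orbit_single (x := y)) => [|y' y'y]; rewrite coeffE eqxx.
    by rewrite eqxx.
  by rewrite (negPf y'y) tensr0.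
by rewrite big1 // => y' _; rewrite coeffE (negPf x'x) tensr0.
Qed.

(** Vanishing off the orbit is recorded so that preimages for different orbits can be added without
    disturbing each other. *)
Lemma orbit_comp_surj (t : tensor (mx_alg R X) W) :
  exists2 a, orbit_comp a = t &
    forall z, ~ X z -> p z 1%g ** subalg_val a = 0.
Proof.
pose Im t := exists2 a, orbit_comp a = t &
  forall z, ~ X z -> p z 1%g ** subalg_val a = 0.
have orbit_comp0 : orbit_comp 0 = 0.
  by apply: orbit_comp_vanish => x; rewrite amulr0.
have Im0 : Im 0 by exists 0 => // z _; rewrite amulr0.
have Im_lin r t1 t2 : Im t1 -> Im t2 -> Im (r *: t1 + t2).
  move=> [a1 a1E a1X] [a2 a2E a2X]; exists (r *: a1 + a2).
    by rewrite orbit_comp_lin a1E a2E.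
  by move=> z zX; rewrite /= amulDr amulZr a1X // a2X // scaler0 addr0.
(* Reduction to elementary tensors, then to a matrix unit in the first factor, then to some [W_h] in
   the second. *)
rewrite [t]tensor_sum_tens; elim: (repr t) => [|[m w] s IH]; first by rewrite big_nil.
rewrite big_cons -[tens _ _]scale1r; apply: (Im_lin) => //= {IH t s}.
move: m (mx_alg_span m); apply: span_ind => [|r _ m [x [y ->]] IH].
  by rewrite tens0l.
rewrite (balDl (tens_balanced _ _)) tensZ; apply: (Im_lin) => // {m r IH}.
(* Induction on the span concerns the underlying element [b], so its lift [w'] is quantified;
   [subalg_ext] returns to the given [w]. *)
suff h b : span (@W_gens R G E T v gw) b ->
    exists2 w' : W, subalg_val w' = b & Im (tens (mx_unit R x y) w').
  by have [w' w'E] := h _ (subalg_in w); rewrite (subalg_ext w'E).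
move: b; apply: span_ind => [|r _ b [h sh ->] [w2 w2b Iw2]].
  by exists 0; rewrite ?tensr0.
have Wh : span (@W_gens R G E T v gw) (W_ R gw h) by apply: span_gen; exists h.
pose w1 : W := @Subalg _ _ (W_alg R gw fin) _ Wh.
exists (r *: w1 + w2); first by rewrite /= w2b.
rewrite tensDr tensZr; apply: (Im_lin) => //.
exists (D_gen (val x) (gw (val x) * h * (gw (val y))^-1)%g).
  exact: orbit_comp_gen.
move=> z zX; rewrite /= (ge_PP (LGE_family R T)) actv1.
by case: eqP => // zx; case: zX; rewrite zx; exact: set_valP.
Qed.

End OrbitComponent.

(** * Assembling the components over all orbits *)

Lemma D_left_unit (R : starRingType) (G : groupType) (E : digraph)
    (T : self_similar G E) (a : LGE R T) : span (@D_gens R G E T) a ->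
  (forall z, p_ R T z 1%g ** a = 0) -> a = 0.
Proof.
(* Finitely many vertex projections sum to a left unit for [a]. Allowing every duplicate-free list
   that contains [s] lets the induction enlarge [s]. *)
move=> Da a0; suff [s h] : exists s : seq (vert E), forall s', uniq s' ->
    {subset s <= s'} -> a = \sum_(z <- s') p_ R T z 1%g ** a.
  rewrite (h (undup s)) ?undup_uniq // => [|z]; last by rewrite mem_undup.
  by rewrite big1.
move: a Da {a0}; apply: span_ind => [|r _ b [z [h ->]] [s IH]].
  by exists [::] => s' _ _; rewrite big1 // => z _; rewrite amulr0.
exists (z :: s) => s' us' ss'; under eq_bigr do rewrite amulDr amulZr.
rewrite big_split -scaler_sumr -IH // => [|w ws]; last first.
  by apply: ss'; rewrite inE ws orbT.
rewrite (sum_seq_single (i := z)) ?ss' ?mem_head // => [|w wz].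
  by rewrite (ge_PP (LGE_family R T)) actv1 eqxx mul1g.
by rewrite (ge_PP (LGE_family R T)) actv1 (negPf wz).
Qed.

Theorem theorem2p10
  (R : starRingType) (G : groupType) (E : digraph) (T : self_similar G E)
  (V : set (vert E))
  (V_orbits : partition V (vorbit T) [set: vert E])
  (gw : forall v : V, orbit_section T (val v))
  (fin : finite_graph E \/ (forall v, V v -> finite_set (vorbit T v))) :
  star_isomorphic
    (subalg (D_alg R T))
    (dirsum (fun v : V =>
       tensor (mx_alg R (vorbit T (val v)))
              (subalg (W_alg R (gw v) (orbit_finite fin v))))).
Proof.
set A := fun v : V => _ : starAlgType R.
have [cov triv _] := V_orbits.
have orb z : exists2 v : V, vorbit T (val v) z & forall u : V,
    vorbit T (val u) z -> u = v.
  have : [set: vert E] z by [].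
  rewrite -cov => -[v Vv vz]; exists (SigSub (mem_set Vv)) => // u uz.
  apply/val_inj/triv => //=; first exact: set_valP.
  by exists z.
pose comp (a : subalg (D_alg R T)) (v : V) : A v :=
  orbit_comp (gw v) (orbit_finite fin v) a.
(* By [q_x q_x^* = p_x] and [q_x^* p_x = q_x^*], the kernel depends on vertex projections alone, not
   on the legs. *)
have comp0P (a : subalg (D_alg R T)) (v : V) : comp a v = 0 <->
    forall z, vorbit T (val v) z -> p_ R T z 1%g ** subalg_val a = 0.
  split=> [a0 z vz|a0].
    rewrite -(leg_proj R (gw v) (SigSub (mem_set vz))) -amulA.
    by rewrite (orbit_comp_eq0 _ a0) amulr0.
  apply: orbit_comp_vanish => x.
  by rewrite -leg_star_proj -amulA a0 ?amulr0 //; exact: set_valP.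
have comp_lin r a b v : comp (r *: a + b) v = r *: comp a v + comp b v.
  exact: orbit_comp_lin.
(* A generator [p_{z,h}] adds only the orbit of [z], so an element of the span meets finitely many
   orbits. *)
have comp_fin a : finite_set [set v | comp a v <> 0].
  have : finite_set [set v : V | exists2 z, vorbit T (val v) z &
      p_ R T z 1%g ** subalg_val a <> 0].
    move: (subalg_val a) (subalg_in a); apply: span_ind => [|r _ b [z [h ->]] bfin].
      by apply: (sub_finite_set _ (finite_set0 V)) => v [z _]; rewrite amulr0.
    have [v0 _ v0P] := orb z.
    have v0bfin : finite_set ([set v0] `|` [set v : V | exists2 z,
        vorbit T (val v) z & p_ R T z 1%g ** b <> 0]).
      by rewrite finite_setU; split=> //; exact: finite_set1.
    apply: sub_finite_set v0bfin => v /= [w vw wb].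
    have [wz|/eqP/negPf wz] := pselect (w = z); first by left; apply: v0P; rewrite -wz.
    right; exists w => // wb0; apply: wb.
    by rewrite amulDr amulZr (ge_PP (LGE_family R T)) actv1 wz scaler0 add0r.
  apply: sub_finite_set => v /= av; apply: contrapT => noz.
  apply: av; apply/comp0P => z vz; apply: contrapT => az.
  by apply: noz; exists z.
pose f a : dirsum A := DirSum (comp_fin a).
have fh : star_hom f.
  split=> [a b|r a|a b|a]; apply: dirsum_ext => v /=.
  - by rewrite -[a]scale1r comp_lin !scale1r.
  - have comp0 : comp 0 v = 0 by apply/comp0P => z _; rewrite amulr0.
    by rewrite -[r *: a]addr0 comp_lin comp0 addr0.
  - exact: orbit_compM.
  - exact: orbit_comp_star.
have f_inj : injective f.
  (* Every vertex [z] lies in some orbit, so equal images force [p_z (a - b) = 0] for all [z], and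
     [D_left_unit] applies. *)
  move=> a b /(congr1 (fun c => c - f b)).
  rewrite subrr -(star_homN fh) -(star_homD fh) => /(congr1 (@ds_val _ _ _)) ab0.
  apply/eqP; rewrite -subr_eq0; apply/eqP/subalg_ext/D_left_unit => [|z].
    exact: (subalg_in (a - b)).
  by have [v vz _] := orb z; apply: (comp0P _ v).1 => //; rewrite -[LHS]/(f _ v) ab0.
have f_surj (d : dirsum A) : exists a, f a = d.
  have [s sd] : exists s : seq V, forall v, d v <> 0 -> v \in s.
    have /finite_seqP[s sE] := ds_fin d.
    by exists s => v dv; have : [set` s] v by rewrite -sE.
  (* The preimage is built one index of [s] at a time; a repeated index requires no new term. *)
  suff [a ad] : exists a, forall v, comp a v = if v \in s then d v else 0.
    exists a; apply: dirsum_ext => v /=; rewrite ad; case: ifPn => // /negP vs.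
    by apply/esym; apply: contrapT => dv; apply: vs; exact: sd.
  elim: s {sd} => [|u s [a IH]].
    by exists 0 => v; apply/comp0P => z _; rewrite amulr0.
  have [us|us] := boolP (u \in s).
    by exists a => v; rewrite IH inE; case: eqP => // ->; rewrite us.
  have [b bu bX] := orbit_comp_surj (d u).
  (* Adding [b] changes only the component at [u]: the vertices of any other orbit lie off that of
     [u], where [bX] applies. The factor [1] fits the form of [comp_lin]. *)
  exists (1 *: b + a) => v; rewrite comp_lin scale1r IH inE.
  case: eqP => [->|vu]; first by rewrite (negPf us) addr0.
  rewrite (comp0P b v).2 ?add0r // => z vz; apply: bX => uz.
  have [w _ wP] := orb z; apply: vu.
  by rewrite (wP _ vz) (wP _ uz).
exists f; split=> //.
have [g gK] := choice f_surj.
by exists g => // a; apply: f_inj; rewrite gK.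
Qed.
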